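(* Let $T\in\mathbb{R}$ and let $\mathbf{c}:(-\infty,T)\times\mathbb{R}\to\mathbb{R}^n$ be a smooth family of immersed curves with $\|\mathbf{c}(t,\epsilon)\|^2=2(T-t)$ for all $t,\epsilon$. Let $\tilde{\mathbf{c}}(\theta,\epsilon)$, $\theta\in\mathbb{R}$, be the family of curves on the unit sphere $\mathbb{S}^{n-1}$ defined by \[ \mathbf{c}(t,\epsilon)=\sqrt{2(T-t)}\;\tilde{\mathbf{c}}\bigl(-\tfrac12\ln(T-t),\epsilon\bigr). \] Then $\mathbf{c}$ evolves by Curve Shortening in $\mathbb{R}^n$ if and only if $\tilde{\mathbf{c}}$ evolves by Curve Shortening on $\mathbb{S}^{n-1}$.
   Context: For a nonzero vector $\mathbf{a}$, $\mathfrak{p}_{\mathbf{a}}(\mathbf{w})=\mathbf{w}-\frac{\langle\mathbf{w},\mathbf{a}\rangle}{\|\mathbf{a}\|^2}\mathbf{a}$ is the orthogonal projection along $\mathbf{a}$. Subscript $s$ denotes differentiation with respect to arc length along the curve at fixed time. A family $\mathbf{c}(t,\cdot)$ in $\mathbb{R}^n$ evolves by Curve Shortening if $\mathfrak{p}_{\mathbf{c}_s}(\mathbf{c}_t)=\mathbf{c}_{ss}$ (which is $\mathbf{c}_t=\mathbf{c}_{ss}$ when the parametrization satisfies $\mathbf{c}_t\perp\mathbf{c}_s$). A family $\tilde{\mathbf{c}}(\theta,\cdot)$ on $\mathbb{S}^{n-1}\subset\mathbb{R}^n$ evolves by Curve Shortening on $\mathbb{S}^{n-1}$ if $\mathfrak{p}_{\tilde{\mathbf{c}}_s}(\tilde{\mathbf{c}}_\theta)=\tilde{\mathbf{c}}_{ss}+\tilde{\mathbf{c}}$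 (which is $\tilde{\mathbf{c}}_\theta=\tilde{\mathbf{c}}_{ss}+\tilde{\mathbf{c}}$ when $\tilde{\mathbf{c}}_\theta\perp\tilde{\mathbf{c}}_s$). *)

(* Defs.v *)
From mathcomp Require Import all_boot all_order all_algebra.
From mathcomp Require Import all_classical all_reals all_analysis.
Set Implicit Arguments.
Unset Strict Implicit.
Unset Printing Implicit Defensive.
Import Order.TTheory GRing.Theory Num.Theory.
Import numFieldNormedType.Exports.
Local Open Scope classical_set_scope.
Local Open Scope ring_scope.

(* The library norm `|u| on 'rV[R]_n is the sup norm; it is only used for the
   topology and for derivatives. Metric notions use the Euclidean norm below. *)
Definition dotv (R : realType) (n : nat) (u v : 'rV[R]_n) : R :=
  \sum_(i < n) u 0 i * v 0 i.

Definition enorm (R : realType) (n : nat) (u : 'rV[R]_n) : R :=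
  Num.sqrt (dotv u u).

Definition proj_along (R : realType) (n : nat) (a w : 'rV[R]_n) : 'rV[R]_n :=
  w - (dotv w a / enorm a ^+ 2) *: a.

(* A family of curves is c : R -> R -> 'rV[R]_n, with the time parameter first
   and the curve parameter second; it is only meaningful for times in a given
   open set I, values at other times being irrelevant. *)
Definition dtime (R : realType) (n : nat) (c : R -> R -> 'rV[R]_n) (t e : R)
  : 'rV[R]_n := derive1 (c ^~ e) t.

Definition dparam (R : realType) (n : nat) (c : R -> R -> 'rV[R]_n) (t e : R)
  : 'rV[R]_n := derive1 (c t) e.

Fixpoint Ck_family (R : realType) (n k : nat) (I : set R)
    (c : R -> R -> 'rV[R]_n) : Prop :=
  (forall t e, I t -> {for (t, e), continuous (fun p : R * R => c p.1 p.2)}) /\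
  match k with
  | 0%N => True
  | k'.+1 =>
      [/\ forall t e, I t -> derivable (c ^~ e) t 1 /\ derivable (c t) e 1,
          Ck_family k' I (dtime c) & Ck_family k' I (dparam c)]
  end.

Definition smooth_family (R : realType) (n : nat) (I : set R)
    (c : R -> R -> 'rV[R]_n) : Prop := forall k : nat, Ck_family k I c.

Definition immersed_family (R : realType) (n : nat) (I : set R)
    (c : R -> R -> 'rV[R]_n) : Prop :=
  forall t e, I t -> dparam c t e != 0.

(* d/ds = |g'|^-1 d/de, for a function f of the parameter e of a curve g. *)
Definition darc (R : realType) (n : nat) (g f : R -> 'rV[R]_n) (e : R)
  : 'rV[R]_n := (enorm (derive1 g e))^-1 *: derive1 f e.

Definition d_s (R : realType) (n : nat) (c : R -> R -> 'rV[R]_n) (t e : R)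
  : 'rV[R]_n := darc (c t) (c t) e.

Definition d_ss (R : realType) (n : nat) (c : R -> R -> 'rV[R]_n) (t e : R)
  : 'rV[R]_n := darc (c t) (d_s c t) e.

Definition curve_shortening (R : realType) (n : nat) (I : set R)
    (c : R -> R -> 'rV[R]_n) : Prop :=
  forall t e, I t -> proj_along (d_s c t e) (dtime c t e) = d_ss c t e.

Definition sphere_family (R : realType) (n : nat) (I : set R)
    (c : R -> R -> 'rV[R]_n) : Prop :=
  forall t e, I t -> enorm (c t e) = 1.

Definition sphere_curve_shortening (R : realType) (n : nat) (I : set R)
    (c : R -> R -> 'rV[R]_n) : Prop :=
  sphere_family I c /\
  forall t e, I t ->
    proj_along (d_s c t e) (dtime c t e) = d_ss c t e + c t e.

(* Main.v *)
Require Import Defs.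
From mathcomp Require Import all_boot all_order all_algebra.
From mathcomp Require Import all_classical all_reals all_analysis.
From mathcomp Require Import ring.
Set Implicit Arguments.
Unset Strict Implicit.
Unset Printing Implicit Defensive.
Import Order.TTheory GRing.Theory Num.Theory.
Import numFieldNormedType.Exports.
Local Open Scope classical_set_scope.
Local Open Scope ring_scope.

(** Put [m = expR theta / sqrt 2] and [t = T - expR (- 2 theta)], so that
    [sqrt (2 (T - t)) = m^-1] and the definition of [ct] inverts to
    [ct theta e = m *: c t e].  At a fixed time this is a dilation: the unit
    tangent is unchanged and the curvature vector is multiplied by [m^-1].  In
    time, both [m] and [t] vary, with [m' = m] and [t' = 2 expR (- 2 theta)],
    whose product with [m] is [m^-1], so that
    [dtime ct theta e = ct theta e + m^-1 *: dtime c t e].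
    Since [enorm (c t e)] does not depend on [e], the position vector is
    orthogonal to the tangent, hence fixed by the projection along it.
    Therefore the defect of the spherical equation for [ct] is [m^-1] times the
    defect of the Euclidean equation for [c] ([rescaled_defect]).  The two
    equations are equivalent because [m != 0] and [theta |-> t] maps the line
    onto the times before [T]. *)

(** * Euclidean geometry of row vectors *)

Lemma dotvDl (R : realType) (n : nat) (u v w : 'rV[R]_n) :
  dotv (u + v) w = dotv u w + dotv v w.
Proof.
by rewrite /dotv -big_split; apply: eq_bigr => i _; rewrite mxE mulrDl.
Qed.

Lemma dotvZl (R : realType) (n : nat) (k : R) (u w : 'rV[R]_n) :
  dotv (k *: u) w = k * dotv u w.
Proof.
by rewrite /dotv mulr_sumr; apply: eq_bigr => i _; rewrite mxE mulrA.
Qed.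

Lemma dotvC (R : realType) (n : nat) (u v : 'rV[R]_n) : dotv u v = dotv v u.
Proof. by apply: eq_bigr => i _; rewrite mulrC. Qed.

Lemma dotvZr (R : realType) (n : nat) (k : R) (u w : 'rV[R]_n) :
  dotv u (k *: w) = k * dotv u w.
Proof. by rewrite dotvC dotvZl dotvC. Qed.

Lemma enorm_ge0 (R : realType) (n : nat) (u : 'rV[R]_n) : 0 <= enorm u.
Proof. exact: sqrtr_ge0. Qed.

Lemma sqr_enorm (R : realType) (n : nat) (u : 'rV[R]_n) :
  enorm u ^+ 2 = dotv u u.
Proof.
by rewrite sqr_sqrtr// sumr_ge0// => i _; rewrite -expr2 sqr_ge0.
Qed.

Lemma enormZ (R : realType) (n : nat) (k : R) (u : 'rV[R]_n) :
  0 <= k -> enorm (k *: u) = k * enorm u.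
Proof.
move=> k0; rewrite /enorm dotvZl dotvZr mulrA -expr2 sqrtrM ?sqr_ge0//.
by rewrite sqrtr_sqr ger0_norm.
Qed.

Lemma proj_alongD (R : realType) (n : nat) (a u v : 'rV[R]_n) :
  proj_along a (u + v) = proj_along a u + proj_along a v.
Proof. by rewrite /proj_along dotvDl mulrDl scalerDl opprD addrACA. Qed.

Lemma proj_alongZ (R : realType) (n : nat) (a : 'rV[R]_n) (k : R)
    (u : 'rV[R]_n) :
  proj_along a (k *: u) = k *: proj_along a u.
Proof. by rewrite /proj_along dotvZl scalerBr scalerA mulrA. Qed.

Lemma proj_along_id (R : realType) (n : nat) (a u : 'rV[R]_n) :
  dotv u a = 0 -> proj_along a u = u.
Proof. by move=> ua; rewrite /proj_along ua mul0r scale0r subr0. Qed.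

(** * Derivatives of vector-valued functions *)

Lemma is_derive_rVP (R : realType) (n : nat) (f : R -> 'rV[R]_n) (x : R)
    (df : 'rV[R]_n) :
  is_derive x 1 f df <->
  forall j, is_derive x 1 (fun y => f y 0 j) (df 0 j).
Proof.
split=> [[fx <-] j|fj].
  have fxj := (derivable_mxP f x 1).1 fx.
  by apply: DeriveDef; [exact: fxj|rewrite derive_mx// mxE].
have fx : derivable f x 1.
  by apply/derivable_mxP => i j; rewrite ord1; apply: ex_derive.
apply: DeriveDef => //; rewrite derive_mx//; apply/rowP => j.
by rewrite mxE derive_val.
Qed.

Lemma is_derive_derive1 (R : realType) (n : nat) (f : R -> 'rV[R]_n) (x : R) :
  derivable f x 1 -> is_derive x 1 f (derive1 f x).
Proof. by move=> fx; rewrite derive1E; exact: derivableP. Qed.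

(** Leibniz and chain rules for [y |-> a y *: f (h y)]. *)
Lemma is_derive_scale_comp (R : realType) (n : nat) (f : R -> 'rV[R]_n)
    (a h : R -> R) (x da dh : R) (df : 'rV[R]_n) :
  is_derive x 1 a da -> is_derive x 1 h dh -> is_derive (h x) 1 f df ->
  is_derive x 1 (fun y => a y *: f (h y)) (da *: f (h x) + (a x * dh) *: df).
Proof.
move=> ax hx /is_derive_rVP fhx; apply/is_derive_rVP => j.
rewrite (_ : (fun y => _) = a * ((fun z => f z 0 j) \o h)); last first.
  by apply/funext => y; rewrite mxE.
have fj := @is_derive1_comp R _ h x _ _ (fhx j) hx.
apply: is_derive_eq; rewrite !mxE /GRing.scale/=; ring.
Qed.

Lemma is_derive_dotv_self (R : realType) (n : nat) (f : R -> 'rV[R]_n) (x : R)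
    (df : 'rV[R]_n) :
  is_derive x 1 f df ->
  is_derive x 1 (fun y => dotv (f y) (f y)) (2 * dotv (f x) df).
Proof.
move=> /is_derive_rVP fx.
rewrite (_ : (fun y => _) =
    \sum_(i < n) (fun y => f y 0 i) * (fun y => f y 0 i)); last first.
  by apply/funext => y; rewrite fct_sumE.
apply: is_derive_eq; rewrite /dotv mulr_sumr; apply: eq_bigr => i _.
rewrite /GRing.scale/=; ring.
Qed.

(** A curve on a sphere centred at the origin is orthogonal to its velocity. *)
Lemma dotv_derive1_eq0 (R : realType) (n : nat) (f : R -> 'rV[R]_n) (x k : R) :
  derivable f x 1 -> (forall y, enorm (f y) ^+ 2 = k) ->
  dotv (f x) (derive1 f x) = 0.
Proof.
move=> /is_derive_derive1/is_derive_dotv_self[_]; move=> + fk.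
rewrite (_ : (fun y => _) = cst k); last first.
  by apply/funext => y; rewrite -sqr_enorm fk.
rewrite derive_val => /esym/eqP; rewrite mulf_eq0 pnatr_eq0/=.
by move/eqP.
Qed.

Lemma smooth_family_derivable (R : realType) (n : nat) (I : set R)
    (c : R -> R -> 'rV[R]_n) (t e : R) :
  smooth_family I c -> I t -> derivable (c ^~ e) t 1 /\ derivable (c t) e 1.
Proof. by move=> /(_ 1%N)[_ [+ _ _]] It; exact. Qed.

(** * Dilations at a fixed time *)

(** Only the curves [c t] and [d s] matter; the dilation is not assumed to
    extend to other times. *)
Section dilation.
Variables (R : realType) (n : nat) (c d : R -> R -> 'rV[R]_n) (t s m : R).
Hypothesis m_gt0 : 0 < m.
Hypothesis c_derivable : forall e, derivable (c t) e 1.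
Hypothesis d_def : forall e, d s e = m *: c t e.

Lemma dparam_dilation e : dparam d s e = m *: dparam c t e.
Proof.
rewrite /dparam (_ : d s = m \*: c t); last by apply/funext => y; rewrite d_def.
by rewrite !derive1E deriveZ.
Qed.

Lemma darc_dilation f e : darc (d s) f e = m^-1 *: darc (c t) f e.
Proof.
rewrite /darc -[derive1 (d s) e]/(dparam d s e) dparam_dilation.
by rewrite enormZ ?ltW// invfM scalerA.
Qed.

Lemma d_s_dilation e : d_s d s e = d_s c t e.
Proof.
rewrite /d_s darc_dilation /darc -[derive1 (d s) e]/(dparam d s e).
rewrite dparam_dilation !scalerA; congr (_ *: _).
by rewrite mulrAC mulVf ?mul1r// gt_eqF.
Qed.

Lemma d_ss_dilation e : d_ss d s e = m^-1 *: d_ss c t e.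
Proof.
rewrite /d_ss darc_dilation (_ : d_s d s = d_s c t)//.
by apply/funext => y; exact: d_s_dilation.
Qed.

End dilation.

(** * The shrinking sphere in logarithmic time *)

(** The inverse of [t |-> - (1 / 2) * ln (T - t)]. *)
Definition shrink_time (R : realType) (T theta : R) : R :=
  T - expR (- 2 * theta).

(** The inverse of the radius [sqrt (2 * (T - t))] at
    [t = shrink_time T theta]; it does not depend on [T]. *)
Definition shrink_factor (R : realType) (theta : R) : R :=
  (Num.sqrt 2)^-1 * expR theta.

Lemma shrink_time_lt (R : realType) (T theta : R) : shrink_time T theta < T.
Proof. by rewrite ltrBlDr ltrDl expR_gt0. Qed.

Lemma shrink_timeK (R : realType) (T theta : R) :
  - (1 / 2) * ln (T - shrink_time T theta) = theta.
Proof. by rewrite opprB addrC subrK expRK; field. Qed.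

Lemma shrink_time_onto (R : realType) (T t : R) :
  t < T -> shrink_time T (- (1 / 2) * ln (T - t)) = t.
Proof.
move=> tT; rewrite /shrink_time (_ : - 2 * _ = ln (T - t)); last by field.
by rewrite lnK ?posrE ?subr_gt0// opprB addrC subrK.
Qed.

Lemma shrink_factor_gt0 (R : realType) (theta : R) : 0 < shrink_factor theta.
Proof. by rewrite mulr_gt0 ?expR_gt0// invr_gt0 sqrtr_gt0. Qed.

Lemma sqr_shrink_factor (R : realType) (T theta : R) :
  shrink_factor theta ^+ 2 * (2 * (T - shrink_time T theta)) = 1.
Proof.
rewrite /shrink_factor /shrink_time opprB (addrC T) subrK exprMn exprVn.
rewrite sqr_sqrtr ?ler0n// expr2 mulrACA mulVf ?pnatr_eq0// mul1r -!expRD.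
by rewrite (_ : _ + _ = 0) ?expR0//; ring.
Qed.

Lemma sqrt_shrink_time (R : realType) (T theta : R) :
  Num.sqrt (2 * (T - shrink_time T theta)) = (shrink_factor theta)^-1.
Proof.
have m0 := shrink_factor_gt0 theta.
apply/eqP; rewrite -(@eqrXn2 _ 2) ?sqrtr_ge0 ?invr_ge0 ?ltW//.
rewrite sqr_sqrtr; last first.
  by rewrite mulr_ge0 ?ler0n// subr_ge0 ltW// shrink_time_lt.
apply/eqP/(mulfI (expf_neq0 2 (lt0r_neq0 m0))).
by rewrite sqr_shrink_factor -exprMn mulfV ?expr1n// gt_eqF.
Qed.

Lemma is_derive_shrink_factor (R : realType) (theta : R) :
  is_derive theta 1 (@shrink_factor R) (shrink_factor theta).
Proof. exact: (@is_deriveZ _ _ _ expR). Qed.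

Lemma is_derive_shrink_time (R : realType) (T theta : R) :
  is_derive theta 1 (shrink_time T) (2 * (T - shrink_time T theta)).
Proof.
have d1 := @is_derive1_comp R expR ( -2 \*: id) theta _ _ (is_derive_expR _)
  (is_deriveZ (-2) (is_derive_id theta 1)).
have := is_deriveB (is_derive_cst T theta 1) d1.
move=> d2; apply: (is_derive_eq d2).
rewrite /shrink_time opprB (addrC T) subrK /GRing.scale/=; ring.
Qed.

(** * The rescaled family *)

Section rescaling.
Variables (R : realType) (n : nat) (T : R) (c ct : R -> R -> 'rV[R]_n).
Hypothesis c_smooth : smooth_family [set t | t < T] c.
Hypothesis c_norm : forall t e : R, t < T -> enorm (c t e) ^+ 2 = 2 * (T - t).
Hypothesis ct_def : forall t e : R, t < T ->
  c t e = Num.sqrt (2 * (T - t)) *: ct (- (1 / 2) * ln (T - t)) e.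

Lemma rescaledE theta e :
  ct theta e = shrink_factor theta *: c (shrink_time T theta) e.
Proof.
rewrite ct_def ?shrink_time_lt// shrink_timeK sqrt_shrink_time scalerA.
by rewrite mulfV ?scale1r// gt_eqF// shrink_factor_gt0.
Qed.

Lemma rescaled_sphere : sphere_family [set: R] ct.
Proof.
move=> theta e _; apply/eqP.
rewrite -(@eqrXn2 _ 2) ?enorm_ge0 ?ler01// rescaledE enormZ; last first.
  by rewrite ltW// shrink_factor_gt0.
by rewrite exprMn c_norm ?shrink_time_lt// sqr_shrink_factor expr1n.
Qed.

Lemma dtime_rescaled theta e :
  dtime ct theta e =
  ct theta e + (shrink_factor theta)^-1 *: dtime c (shrink_time T theta) e.
Proof.
have [cd _] := smooth_family_derivable e c_smooth (shrink_time_lt T theta).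
have := is_derive_scale_comp (is_derive_shrink_factor theta)
  (is_derive_shrink_time T theta) (is_derive_derive1 cd).
rewrite {1}/dtime (_ : ct ^~ e = fun y =>
  shrink_factor y *: c (shrink_time T y) e); last first.
  by apply/funext => y; exact: rescaledE.
move=> dct; rewrite derive1E derive_val -rescaledE; congr (_ + _ *: _).
have m0 := lt0r_neq0 (shrink_factor_gt0 theta).
by apply: (mulfI m0); rewrite mulfV// [LHS]mulrA -expr2 sqr_shrink_factor.
Qed.

Lemma position_orthogonal_tangent t e : t < T -> dotv (c t e) (d_s c t e) = 0.
Proof.
move=> tT; have [_ cd] := smooth_family_derivable e c_smooth tT.
rewrite /d_s /darc dotvZr (@dotv_derive1_eq0 _ _ _ _ (2 * (T - t)))// ?mulr0//.
by move=> y; exact: c_norm.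
Qed.

(** The radial term [ct theta e] of the spherical equation is what the growth of
    the dilation factor contributes to [dtime ct]; the two cancel here. *)
Lemma rescaled_defect theta e :
  let t := shrink_time T theta in
  proj_along (d_s ct theta e) (dtime ct theta e)
    - (d_ss ct theta e + ct theta e)
  = (shrink_factor theta)^-1
    *: (proj_along (d_s c t e) (dtime c t e) - d_ss c t e).
Proof.
move=> t; have tT : t < T := shrink_time_lt T theta.
have m0 := shrink_factor_gt0 theta.
have cd y := (smooth_family_derivable y c_smooth tT).2.
rewrite (d_s_dilation m0 cd (rescaledE theta)).
rewrite (d_ss_dilation m0 cd (rescaledE theta)).
rewrite dtime_rescaled proj_alongD proj_alongZ -/t proj_along_id; last first.
  by rewrite rescaledE dotvZl position_orthogonal_tangent ?mulr0.
rewrite [RHS]scalerBr [in LHS](addrC (_ *: d_ss _ _ _)) opprD addrACA.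
by rewrite subrr add0r.
Qed.

End rescaling.

Theorem lemma3p2 (R : realType) (n : nat) (T : R) (c ct : R -> R -> 'rV[R]_n)
    (c_smooth : smooth_family [set t | t < T] c)
    (c_immersed : immersed_family [set t | t < T] c)
    (c_norm : forall t e : R, t < T -> enorm (c t e) ^+ 2 = 2 * (T - t))
    (ct_def : forall t e : R, t < T ->
       c t e = Num.sqrt (2 * (T - t)) *: ct (- (1 / 2) * ln (T - t)) e) :
  curve_shortening [set t | t < T] c <->
  sphere_curve_shortening [set: R] ct.
Proof.
have defect := rescaled_defect c_smooth c_norm ct_def.
split=> [cs|[_ scs] t e tT].
  split=> [|theta e _]; first exact: (rescaled_sphere c_norm ct_def).
  apply/eqP; rewrite -subr_eq0 defect cs ?subrr ?scaler0//.
  exact: shrink_time_lt.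
apply/eqP; rewrite -subr_eq0 -(shrink_time_onto tT).
set theta := - (1 / 2) * ln (T - t).
have := defect theta e; rewrite scs// subrr => /esym/eqP.
by rewrite scaler_eq0 invr_eq0 gt_eqF ?shrink_factor_gt0.
Qed.
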